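(* Let $J$ be the Jordan canonical form of an $n\times n$ complex matrix $A$. If $J$ is nonsingular, then $K=0$ is the only anti-commuting solution of $JYJ=YJY$.
   Context: An anti-commuting solution of $JYJ=YJY$ is an $n\times n$ complex matrix $K$ with $JKJ=KJK$ and $JK=-KJ$. *)

(* Defs.v *)
From mathcomp Require Import all_boot all_order all_algebra.

Set Implicit Arguments.
Unset Strict Implicit.
Unset Printing Implicit Defensive.

Import GRing.Theory.
Local Open Scope ring_scope.

(* Eigenvalue on the diagonal, ones on the superdiagonal. *)
Definition jordan_block (F : fieldType) (a : F) (m : nat) : 'M[F]_m :=
  \matrix_(i, j) (a *+ (i == j) + (i.+1 == j :> nat)%:R).

(* Since \mxdiag_i B_ i has size \sum_i p i, the equation e transports it to
   size n. The order of the blocks is not prescribed. *)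
Definition jordan_matrix (F : fieldType) (n : nat) (J : 'M[F]_n) : Prop :=
  exists (k : nat) (p : 'I_k -> nat) (a : 'I_k -> F) (e : \sum_i p i = n),
    (forall i, 0 < p i)%N /\
    J = castmx (e, e) (\mxdiag_i jordan_block (a i) (p i)).

(* The Jordan form of A is determined up to the order of its blocks, so it is
   a relation: J is one of these block orderings. *)
Definition jordan_form_of (F : fieldType) (n : nat) (A J : 'M[F]_n) : Prop :=
  jordan_matrix J /\ A ~_{in unitmx} J.

Definition anticommuting_solution (F : fieldType) (n : nat)
    (J K : 'M[F]_n) : Prop :=
  J *m K *m J = K *m J *m K /\ J *m K = - (K *m J).

(* Main.v *)
Require Import Defs.
From mathcomp Require Import all_boot all_order all_algebra.
From mathcomp Require Import reals complex.

(** Invertibility of [J] enters through cancellation.  Anticommutation moves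
    every [J] to the right, which turns [J K J = K J K] into [K J J = K K J],
    and cancelling [J] gives [K J = K K].  Hence [K K J = K K K], whereas
    [J K K = - K J K = - K K K].  But [J] commutes with [K K], since the two
    signs picked up in moving it past two factors [K] cancel, so
    [K K K = - K K K] and [K K K = 0] away from characteristic 2.
    Cancelling [J] in [K K J = 0] and then in [K J = K K = 0] gives [K = 0]. *)

Import GRing.Theory Num.Theory.
Local Open Scope ring_scope.

(** Characteristic 2 must be excluded: there [J = K = 1%:M] is an
    anticommuting solution, nonzero as soon as [0 < n]. *)
Lemma anticommuting_solution_unitmx_eq0 (F : fieldType) (n : nat)
    (J K : 'M[F]_n) :
  (2%:R : F) != 0 -> J \in unitmx -> anticommuting_solution J K -> K = 0.
Proof.
move=> two_neq0 uJ [JKJ JK].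
have cancelJ (B C : 'M[F]_n) : B *m J = C *m J -> B = C.
  by move/(congr1 (mulmx^~ (invmx J))); rewrite !mulmxK.
have KJ : K *m J = K *m K.
  apply: cancelJ; apply: oppr_inj.
  by rewrite -mulNmx -JK JKJ -mulmxA JK mulmxN mulmxA.
have KKJ : K *m K *m J = K *m K *m K by rewrite -mulmxA KJ mulmxA.
have KKK0 : K *m K *m K = 0.
  have KKKN : K *m K *m K = - (K *m K *m K).
    have JKK : J *m (K *m K) = - (K *m K *m K).
      by rewrite mulmxA JK mulNmx KJ.
    by rewrite -JKK [RHS]mulmxA JK mulNmx -[in RHS]mulmxA JK mulmxN opprK
      [RHS]mulmxA KKJ.
  apply/eqP; have /eqP := KKKN.
  by rewrite -addr_eq0 -mulr2n -scaler_nat scaler_eq0 (negPf two_neq0).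
have KK0 : K *m K = 0 by apply: cancelJ; rewrite KKJ KKK0 mul0mx.
by apply: cancelJ; rewrite KJ KK0 mul0mx.
Qed.

Theorem theorem3p3 (R : realType) (n : nat) (A J : 'M[R[i]]_n)
    (hJ : jordan_form_of A J) (hu : J \in unitmx) (K : 'M[R[i]]_n) :
  anticommuting_solution J K <-> K = 0.
Proof.
split=> [|->]; last by split; rewrite !(mulmx0, mul0mx) ?oppr0.
by apply: anticommuting_solution_unitmx_eq0; rewrite // pnatr_eq0.
Qed.
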